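(* Let $(A,\leq)$ be a finite partially ordered set and $R\subseteq A\times A$ be convex with respect to $\leq$. Then $t(R)=t_r(t_\ell(R))$. In particular, if $G=(V,E)$ is a finite directed graph with vertex weights $w:V\to\mathbb{R}^+$ such that $w(u)<w(v)$ for all $(u,v)\in E$, edge costs $d((u,v))=w(v)-w(u)$, and $\gamma\geq 0$, then, with respect to the partial order $\leq_E$ given by the reflexive and transitive closure of $E$, $t_r(t_\ell(R_{G,\gamma}))$ is the set of tight pairs of $G$ at threshold $\gamma$.
   Context: $R\subseteq A\times A$ is convex with respect to $\leq$ if $(a,b)\in R$ implies $a\leq b$, and whenever $a\leq b\leq c$ and $(a,c)\in R$, then $(a,b)\in R$ and $(b,c)\in R$. Using $\leq$ on both factors: $t(R)=\{(a,b)\in R\mid \forall a',b'\in A\,((a'\leq a\wedge b\leq b'\wedge (a',b')\in R)\Rightarrow(a'=a\wedge b'=b))\}$; $t_r(R)=\{(a,b)\in R\mid \forall b'\in A\,((b\leq b'\wedge (a,b')\in R)\Rightarrow b'=b)\}$; $t_\ell(R)=\{(a,b)\in R\mid \forall a'\in A\,((a'\leq a\wedge (a',b)\in R)\Rightarrow a'=a)\}$. For the graph: a path is a sequence $(u_1,\ldots,u_k)$, $k\geq1$, with $(u_i,u_{i+1})\in E$, of cost equal to the sum of its edge costs. A path $p=(u_1,\ldots,u_k)$ is tight if its cost is $\leq\gamma$ and every path obtained by adding one new edge $(u_0,u_1)\in E$ at the start or $(u_k,u_{k+1})\in E$ at the end has cost $>\gamma$. A tight pair is a pair $(u,v)$ such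 that some tight path starts at $u$ and ends at $v$. $R_{G,\gamma}$ is the set of pairs $(u,v)\in V\times V$ such that there is a path from $u$ to $v$ in $G$ and $w(v)-w(u)\leq\gamma$. *)

(* Defs.v *)
From mathcomp Require Import all_boot all_order all_algebra.
From mathcomp Require Import classical_sets reals.

Set Implicit Arguments.
Unset Strict Implicit.
Unset Printing Implicit Defensive.

Import Order.TTheory GRing.Theory Num.Theory.

Local Open Scope classical_set_scope.
Local Open Scope ring_scope.

(* The order is passed as a relation, so that the same operators apply both to *)
(* the canonical order of a finPOrderType and to the reachability order        *)
(* [connect E] of a digraph.                                                   *)
Section Convex.
Variables (A : Type) (le : rel A).
Implicit Types R : set (A * A).

Definition convex_rel R : Prop :=
  (forall a b, R (a, b) -> le a b) /\
  (forall a b c, le a b -> le b c -> R (a, c) -> R (a, b) /\ R (b, c)).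

Definition tight R : set (A * A) :=
  [set p | R p /\ forall a' b',
     le a' p.1 /\ le p.2 b' /\ R (a', b') -> a' = p.1 /\ b' = p.2].

Definition tight_r R : set (A * A) :=
  [set p | R p /\ forall b', le p.2 b' /\ R (p.1, b') -> b' = p.2].

Definition tight_l R : set (A * A) :=
  [set p | R p /\ forall a', le a' p.1 /\ R (a', p.2) -> a' = p.1].

End Convex.

(* A path (u_1, ..., u_k), k >= 1, is given by its head u = u_1 and its tail   *)
(* s = [:: u_2; ...; u_k], subject to [path E u s]; it ends at [last u s].     *)
Section Graph.
Variables (K : realType) (V : finType) (E : rel V).

Definition path_cost (d : V * V -> K) (u : V) (s : seq V) : K :=
  \sum_(c <- pairmap (fun x y => d (x, y)) u s) c.

Definition tight_path (d : V * V -> K) (gamma : K) (u : V) (s : seq V) : Prop :=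
  [/\ path E u s,
      path_cost d u s <= gamma,
      forall u0, E u0 u -> gamma < path_cost d u0 (u :: s)
    & forall v, E (last u s) v -> gamma < path_cost d u (rcons s v)].

Definition tight_pairs (d : V * V -> K) (gamma : K) : set (V * V) :=
  [set p | exists s, tight_path d gamma p.1 s /\ last p.1 s = p.2].

Definition reach_within (w : V -> K) (gamma : K) : set (V * V) :=
  [set p | (exists s, path E p.1 s /\ last p.1 s = p.2) /\
           w p.2 - w p.1 <= gamma].

End Graph.

(* Main.v *)
(** If [a' <= a], [b <= b'] and [(a', b')] is in a convex [R], then so is
    [(a', b)]: hence left-maximality at [b] forces [a' = a], and it passes from
    [b] to every larger [b'] with [(a, b')] in [R], which identifies the
    two-sided maximal pairs with the iterated one-sided ones.  For the graph, all
    paths from [u] to [v] cost [w v - w u] and [w] increases along paths, so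
    [reach_within] is convex and a proper enlargement of a pair exists as soon as
    one by a single edge does. *)

Require Import Defs.
From mathcomp Require Import all_boot all_order all_algebra.
From mathcomp Require Import classical_sets reals.

Import Order.TTheory GRing.Theory Num.Theory.

Local Open Scope classical_set_scope.
Local Open Scope ring_scope.

Lemma tight_tight_rl (A : Type) (le : rel A) (R : set (A * A)) :
  reflexive le -> transitive le -> convex_rel le R ->
  tight le R = tight_r le (tight_l le R).
Proof.
move=> le_refl le_trans [Rle Rconv]; apply/seteqP; split=> -[a b] /=.
  move=> [Rab tab]; split=> /= [|b' [leb' [/= Rab' _]]].
    by split=> //= a' [lea' Ra'b]; case: (tab a' b).
  by case: (tab a b').
move=> [[/= Rab tl] tr]; split=> //= a' b' [lea'a [lebb' Ra'b']].
(* Left-maximality passes from [b] to [b']: convexity applied to [x <= b <= b'] puts [(x, b)] in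
   [R]. This is used twice, to get [a' = a] and to place [(a, b')] in [tight_l le R], where [tr]
   applies. *)
have shrink x : le x a -> R (x, b') -> x = a.
  move=> lexa Rxb'; apply: tl; split=> //.
  by case: (Rconv x b b' (le_trans _ _ _ lexa (Rle _ _ Rab)) lebb' Rxb').
have Ea := shrink _ lea'a Ra'b'; split=> //; apply: tr; split=> //.
by split=> [|x [lexa Rxb']] /=; [rewrite -Ea | exact: shrink].
Qed.

Section WeightedDigraph.
Context {K : realType} {V : finType} {E : rel V} {w : V -> K} {d : V * V -> K}.
Hypothesis w_lt : forall u v, E u v -> w u < w v.
Hypothesis dE : forall u v, E u v -> d (u, v) = w v - w u.

(** The edge costs telescope, so the cost depends only on the endpoints. *)
Lemma path_costE u s : path E u s -> path_cost d u s = w (last u s) - w u.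
Proof.
elim: s u => [|x s IHs] u /=; first by rewrite /path_cost big_nil subrr.
move=> /andP[Eux xs]; rewrite /path_cost /= big_cons dE // [X in _ + X]IHs //.
by rewrite addrC subrKA.
Qed.

Lemma connect_weight_le u v : connect E u v -> w u <= w v.
Proof.
move=> /connectP[s us ->] {v}; elim: s u us => [|x s IHs] u //= /andP[/w_lt ux].
by move/IHs; apply/le_trans/ltW.
Qed.

(** The first edge of a nontrivial closed walk strictly raises the weight, and the rest of the walk
    cannot lower it back. *)
Lemma connect_antisym : antisymmetric (connect E).
Proof.
move=> u v /andP[/connectP[[|x s] //= /andP[Eux xs] ->] vu].
have xv : connect E x (last x s) by apply/connectP; exists s.
have := connect_weight_le _ _ (connect_trans xv vu).
by rewrite leNgt (w_lt _ _ Eux).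
Qed.

Lemma reach_withinE gamma u v :
  reach_within E w gamma (u, v) <-> connect E u v /\ w v - w u <= gamma.
Proof.
split=> -[uv ?]; split=> //; first by case: uv => s [us ?]; apply/connectP; exists s.
by case/connectP: uv => s us ->; exists s.
Qed.

Lemma reach_within_convex gamma : convex_rel (connect E) (reach_within E w gamma).
Proof.
split=> [a b /reach_withinE[]//|a b c ab bc /reach_withinE[ac le_gamma]].
have wab := connect_weight_le _ _ ab; have wbc := connect_weight_le _ _ bc.
split; apply/reach_withinE; split=> //; apply: le_trans le_gamma.
  by rewrite lerD2r.
by rewrite lerD2l lerN2.
Qed.

(** Since cost depends only on the endpoints, any path joining a two-sided maximal pair can serve as
    the tight path. *)
Lemma tight_reach_within gamma :
  tight (connect E) (reach_within E w gamma) = tight_pairs E d gamma.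
Proof.
apply/seteqP; split=> -[u v] /=.
  move=> [[[s /= [us sv]] le_gamma] tuv]; subst v; exists s; split=> //.
  have uv : connect E u (last u s) by apply/connectP; exists s.
  split=> //=; first by rewrite path_costE.
  (* An affordable edge into [u] would give a larger pair in the relation; maximality then forces
     [x = u], against [w x < w u]. *)
  - move=> x Exu; rewrite path_costE /= ?Exu // ltNge; apply/negP => le_x.
    case: (tuv x (last u s)) => [|Exq _].
      split; first exact: connect1.
      split=> //; apply/reach_withinE; split=> //.
      exact: connect_trans (connect1 Exu) uv.
    by have := w_lt _ _ Exu; rewrite Exq ltxx.
  - move=> x Evx; rewrite path_costE ?rcons_path ?us // last_rcons ltNge.
    apply/negP => le_x; case: (tuv u x) => [|_ Exq].
      split=> //; split; first exact: connect1.
      by apply/reach_withinE; split=> //; apply: connect_trans uv (connect1 Evx).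
    by have := w_lt _ _ Evx; rewrite Exq ltxx.
move=> [s [[/= us le_gamma tl tr] sv]]; subst v.
split=> /= [|a b [au [vb /reach_withinE[_ le_ab]]]].
  by split=> /=; [exists s | rewrite -path_costE].
have wau := connect_weight_le _ _ au; have wvb := connect_weight_le _ _ vb.
split.
  (* If [a] differs from [u], take the last edge [(x, u)] of a path from [a]. As [w a <= w x] and
     [w] at the end of [s] is at most [w b], prepending this edge costs at most
     [w b - w a <= gamma]. *)
  case/connectP: au => q; case/lastP: q => [//|q x].
  rewrite rcons_path last_rcons => /andP[aq Exu] Eu; subst x.
  have aq' : connect E a (last a q) by apply/connectP; exists q.
  have := tl _ Exu; rewrite path_costE /= ?Exu // ltNge => /negP[].
  apply: le_trans le_ab; apply: lerB => //; exact: connect_weight_le.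
(* Symmetrically, the first edge of a path towards [b] is an affordable extension at the end. *)
case/connectP: vb => -[//|x q] /= /andP[Evx xq] Eb.
have xb : connect E x b by apply/connectP; exists q.
have := tr _ Evx; rewrite path_costE ?rcons_path ?us // last_rcons ltNge.
move=> /negP[]; apply: le_trans le_ab; apply: lerB => //.
exact: connect_weight_le.
Qed.

End WeightedDigraph.

Theorem theorem2 :
  (forall (disp : Order.disp_t) (A : finPOrderType disp) (R : set (A * A)),
     convex_rel (@Order.le disp A) R ->
     tight (@Order.le disp A) R =
       tight_r (@Order.le disp A) (tight_l (@Order.le disp A) R)) /\
  (forall (K : realType) (V : finType) (E : rel V) (w : V -> K)
      (d : V * V -> K) (gamma : K),
     (forall v, 0 < w v) ->
     (forall u v, E u v -> w u < w v) ->
     (forall u v, E u v -> d (u, v) = w v - w u) ->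
     0 <= gamma ->
     [/\ reflexive (connect E), antisymmetric (connect E)
       & transitive (connect E)] /\
     tight_r (connect E) (tight_l (connect E) (reach_within E w gamma)) =
       tight_pairs E d gamma).
Proof.
split=> [disp A R Rconv|K V E w d gamma _ w_lt dE _].
  exact: tight_tight_rl lexx le_trans Rconv.
split.
  by split; [exact: connect0 | exact: connect_antisym w_lt | exact: connect_trans].
rewrite -(tight_reach_within w_lt dE); symmetry; apply: tight_tight_rl.
- exact: connect0.
- exact: connect_trans.
- exact: reach_within_convex w_lt gamma.
Qed.
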